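(* For every integer $k\ge 1$ there exists $n_0(k)$ such that for every negative odd integer $t$ with $-k\le t$ and every integer $n>n_0(k)$, \[ \alpha[J_{\pm}(n,k,t)] = S\left(k,|t|-1\right)\binom{n}{k}. \]
   Context: For integers $n\ge k\ge 1$ and $t$, $J_{\pm}(n,k,t)$ denotes the graph whose vertex set consists of all vectors in $\{-1,0,1\}^n$ with exactly $k$ nonzero coordinates, two vertices being joined by an edge if and only if their scalar product (standard inner product in $\mathbb{R}^n$) equals $t$. The independence number $\alpha[G]$ of a graph $G$ is the maximum size of an independent set, i.e. a set of vertices no two of which are joined by an edge. For nonnegative integers $m$ and $D$ define \[ S(m,D) := \begin{cases} \sum_{j=0}^{d}\binom{m}{j} & \text{if } D=2d,\\ \binom{m-1}{d}+\sum_{j=0}^{d}\binom{m}{j} & \text{if } D=2d+1. \end{cases} \] *)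

(* Defs.v *)
From mathcomp Require Import all_boot all_order all_algebra.

Set Implicit Arguments.
Unset Strict Implicit.
Unset Printing Implicit Defensive.

Import Order.TTheory GRing.Theory Num.Theory.
Local Open Scope ring_scope.

Record sgraph := SGraph {
  vertex :> finType;
  edge : rel vertex;
  edge_sym : symmetric edge;
  edge_irrefl : irreflexive edge }.

Definition independent (G : sgraph) (A : {set G}) : bool :=
  [forall x in A, forall y in A, ~~ edge x y].

Definition alpha (G : sgraph) : nat :=
  (\max_(A : {set G} | independent A) #|A|)%N.

(* The finite subtype {-1, 0, 1} of int. *)
Definition trit : finType := seq_sub [:: -1; 0; 1 : int].

Definition nnz (n : nat) (x : {ffun 'I_n -> trit}) : nat :=
  #|[set i | val (x i) != 0]|.

Definition scalar_prod (n : nat) (x y : {ffun 'I_n -> trit}) : int :=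
  \sum_(i < n) val (x i) * val (y i).

Definition Jpm_vertex (n k : nat) : finType :=
  {x : {ffun 'I_n -> trit} | nnz x == k}.

(* Loops are excluded explicitly; since <x, x> = k on vertices, the condition
   x != y only matters when t = k. *)
Definition Jpm_edge (n k : nat) (t : int) : rel (Jpm_vertex n k) :=
  fun x y => (x != y) && (scalar_prod (val x) (val y) == t).

Lemma Jpm_edge_sym (n k : nat) (t : int) : symmetric (@Jpm_edge n k t).
Proof.
move=> x y; rewrite /Jpm_edge eq_sym; congr (_ && (_ == _)).
by apply: eq_bigr => i _; rewrite mulrC.
Qed.

Lemma Jpm_edge_irrefl (n k : nat) (t : int) : irreflexive (@Jpm_edge n k t).
Proof. by move=> x; rewrite /Jpm_edge eqxx. Qed.

Definition Jpm (n k : nat) (t : int) : sgraph :=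
  SGraph (@Jpm_edge_sym n k t) (@Jpm_edge_irrefl n k t).

(* The half D./2 is d in both cases D = 2d and D = 2d+1.  Only for m = 0 and D
   odd does the truncated m.-1 differ from m - 1; there binomial(-1, d) is read
   as 'C(0, d). *)
Definition Ssum (m D : nat) : nat :=
  if odd D then ('C(m.-1, D./2) + \sum_(0 <= j < D./2.+1) 'C(m, j))%N
  else (\sum_(0 <= j < D./2.+1) 'C(m, j))%N.

(* Main.v *)
(* Write |t| = 2d+1. The vectors with at most d entries -1 have pairwise scalar
   products at least -2d, which gives the lower bound.

   For the upper bound, let F be independent and let F_K be the family of
   negative sets of the vectors of F with support K. Kleitman's theorem bounds
   F_K by S(k,2d) as soon as any two of its members differ in at most 2d places,
   with equality only for Hamming balls if k > 2d+1. Call a sign pattern u on a (2d+1)-set T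
   bad if both u and -u occur in F. The supports of the vectors carrying u meet
   outside T the support of any vector carrying -u, so a bad pattern occurs on
   only O(n^(k-2d-2)) supports K; these are the only ones with |F_K| > S(k,2d).
   On each of the other supports containing T neither u nor -u occurs, while a
   Hamming ball of radius d contains one of them; hence |F_K| < S(k,2d) there.
   There are of order n^(k-2d-1) such supports, so for large n the loss exceeds
   the gain. If k = 2d+1, no pattern is bad. *)
Require Import Defs.
From mathcomp Require Import all_boot all_order all_algebra.
From mathcomp Require Import zify.

Set Implicit Arguments.
Unset Strict Implicit.
Unset Printing Implicit Defensive.

Import GRing.Theory.

(** * Families with bounded pairwise unions *)

(** Membership of [phi A] is tested in the original [F], so all members move simultaneously. *)
Definition compress (X : finType) (phi : {set X} -> {set X})
    (F : {set {set X}}) : {set {set X}} :=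
  [set if phi A \in F then A else phi A | A in F].

(** A moved member lands outside [F], so it cannot meet one that stays; two moved members are
    separated by the hypothesis on [phi]. *)
Lemma compress_injective (X : finType) (phi : {set X} -> {set X})
    (F : {set {set X}}) :
  {in [pred A | phi A != A] &, injective phi} ->
  {in F &, injective (fun A => if phi A \in F then A else phi A)}.
Proof.
move=> injphi A B AF BF /=.
case: ifPn => pA; case: ifPn => pB // eqAB.
- by rewrite -eqAB AF in pB.
- by rewrite eqAB BF in pA.
apply: injphi => //; rewrite inE.
  by apply: contraNneq pA => ->.
by apply: contraNneq pB => ->.
Qed.

Lemma card_compress (X : finType) (phi : {set X} -> {set X})
    (F : {set {set X}}) :
  {in [pred A | phi A != A] &, injective phi} -> #|compress phi F| = #|F|.
Proof. by move=> injphi; rewrite card_in_imset //; exact: compress_injective. Qed.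

(** Makes [w] a termination measure for compressing until the family is stable. *)
Lemma sum_compress_lt (X : finType) (phi : {set X} -> {set X})
    (F : {set {set X}}) (w : {set X} -> nat) (A : {set X}) :
  {in [pred A | phi A != A] &, injective phi} ->
  (forall B, phi B != B -> w (phi B) < w B) ->
  A \in F -> phi A \notin F ->
  \sum_(B in compress phi F) w B < \sum_(B in F) w B.
Proof.
move=> injphi wphi AF pA.
rewrite big_imset /=; last exact: compress_injective.
rewrite (bigD1 A) //= [X in _ < X](bigD1 A) //= (negPf pA) -addSn leq_add //.
  by apply: wphi; apply: contraNneq pA => ->.
apply: leq_sum => B /andP[BF _]; case: ifPn => // pB.
by apply/ltnW/wphi; apply: contraNneq pB => ->.
Qed.

Lemma card_le_powerset (X : finType) (Y : {set X}) (d : nat) :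
  #|[set A : {set X} | A \subset Y & #|A| <= d]|
    = \sum_(0 <= j < d.+1) 'C(#|Y|, j).
Proof.
elim: d => [|d IH].
  rewrite big_nat1 -cards_draws; apply: eq_card => A.
  by rewrite !inE leqn0.
rewrite big_nat_recr //= -IH -cards_draws.
rewrite -cardsUI [X in _ + X](_ : _ = 0).
  rewrite addn0; apply: eq_card => A; rewrite !inE -andb_orr.
  by rewrite [_ <= d.+1]leq_eqVlt orbC.
apply/eqP; rewrite cards_eq0; apply/eqP/setP=> A; rewrite !inE.
by case: (A \subset Y) => //=; lia.
Qed.

Lemma sum_bin_recr (n d : nat) :
  \sum_(0 <= j < d.+2) 'C(n.+1, j)
    = \sum_(0 <= j < d.+2) 'C(n, j) + \sum_(0 <= j < d.+1) 'C(n, j).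
Proof.
rewrite big_nat_recl // [in RHS]big_nat_recl // !bin0 -addnA; congr addn.
by rewrite -big_split; apply: eq_bigr => j _; rewrite binS.
Qed.

Lemma exists_subset_card (X : finType) (Y : {set X}) (m : nat) :
  m <= #|Y| -> exists2 B : {set X}, B \subset Y & #|B| = m.
Proof.
rewrite -bin_gt0 -cards_draws => /card_gt0P[B]; rewrite inE => /andP[BY /eqP cB].
by exists B.
Qed.

Definition shift (X : finType) (x y : X) (A : {set X}) : {set X} :=
  if (x \in A) && (y \notin A) then y |: (A :\ x) else A.

Lemma shift_injective (X : finType) (x y : X) :
  {in [pred A | shift x y A != A] &, injective (shift x y)}.
Proof.
move=> A B; rewrite !inE /shift.
case: andP => [[xA yA] _|]; last by rewrite eqxx.
case: andP => [[xB yB] _|]; last by rewrite eqxx.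
move=> /setP eqAB; apply/setP => z; move: (eqAB z); rewrite !inE.
case: (eqVneq z x) => [-> _|zx]; first by rewrite xA xB.
by case: (eqVneq z y) => [-> _|//]; rewrite (negPf yA) (negPf yB).
Qed.

Lemma card_shift (X : finType) (x y : X) (A : {set X}) : #|shift x y A| = #|A|.
Proof.
rewrite /shift; case: ifP => // /andP[xA yA].
by rewrite cardsU1 !inE (negPf yA) andbF (cardsD1 x A) xA.
Qed.

(** As [x] is outside [B], the union loses [x] and gains at most [y]. *)
Lemma card_setU_shift (X : finType) (x y : X) (A B : {set X}) :
  x \in A -> y \notin A -> x \notin B ->
  #|(y |: A :\ x) :|: B| <= #|A :|: B|.
Proof.
move=> xA yA xB.
have -> : (y |: A :\ x) :|: B = y |: ((A :|: B) :\ x).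
  apply/setP => z; rewrite !inE.
  by case: (eqVneq z x) => [->|_] /=; rewrite ?(negPf xB) ?orbF ?orbA.
rewrite [X in _ <= X](cardsD1 x) inE xA /= cardsU1 leq_add2r.
by case: (y \notin _).
Qed.

Lemma compress_shift_union (X : finType) (x y : X) (F : {set {set X}}) (D : nat) :
  {in F &, forall A B, #|A :|: B| <= D} ->
  {in compress (shift x y) F &, forall A B, #|A :|: B| <= D}.
Proof.
move=> UF.
(* [A] moves and [B] stays. If [B] contains [x] but not [y], the new union equals
   [A :|: shift x y B]; otherwise the shift fixes [B], and the new union is no larger than
   [A :|: B]. *)
have mixed A B : A \in F -> B \in F -> shift x y A \notin F ->
    shift x y B \in F -> #|shift x y A :|: B| <= D.
  move=> AF BF sA sB; move: (sA) (sB) (UF _ _ AF sB).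
  rewrite /shift; case: ifP => [/andP[xA yA] _|]; last by rewrite AF.
  case: ifPn => [/andP[xB yB] _|xyB _].
    congr (_ <= _).
    apply: eq_card => z; rewrite !inE.
    by case: (eqVneq z y) => [->|_] /=; rewrite ?orbT //;
      case: (eqVneq z x) => [->|//]; rewrite xA xB.
  have [xB|xB] := boolP (x \in B); last first.
    by apply: leq_trans; exact: card_setU_shift.
  move: xyB; rewrite xB /= negbK => yB.
  apply: leq_trans; apply/subset_leq_card/subsetP => z; rewrite !inE.
  case: (eqVneq z y) => [->|_] /=; rewrite ?yB ?orbT //.
  by move=> /orP[/andP[_ ->]|->]; rewrite ?orbT.
move=> _ _ /imsetP[A AF ->] /imsetP[B BF ->].
case: ifPn => sA; case: ifPn => sB.
- exact: UF.
- by rewrite setUC; exact: mixed.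
- exact: mixed.
move: (sA) (sB) (UF _ _ AF BF); rewrite /shift.
case: ifP => [/andP[xA yA] _|]; last by rewrite AF.
case: ifP => [/andP[xB yB] _|]; last by rewrite BF.
apply: leq_trans.
have -> : (y |: A :\ x) :|: (y |: B :\ x) = (y |: A :\ x) :|: (B :\ x).
  by apply/setP=> z; rewrite !inE; case: (z == y); rewrite ?orbT.
apply: leq_trans (card_setU_shift xA yA _) _; first by rewrite !inE eqxx.
apply/subset_leq_card/setUS; exact: subsetDl.
Qed.

(** A set and its complement have union [Y], of size 2d+1, so [F] never contains both. Complementing
    the members of size above d thus maps [F] injectively into the sets of size at most d. *)
Lemma union_bound_base (X : finType) (Y : {set X}) (d : nat)
    (F : {set {set X}}) :
  F \subset powerset Y -> #|Y| = d.*2.+1 ->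
  {in F &, forall A B, #|A :|: B| <= d.*2} ->
  #|F| <= \sum_(0 <= j < d.+1) 'C(#|Y|, j).
Proof.
move=> FY cY UF; rewrite -card_le_powerset.
pose f (A : {set X}) := if #|A| <= d then A else Y :\: A.
have FYP A : A \in F -> A \subset Y by move=> /(subsetP FY); rewrite inE.
have nocompl A B : A \in F -> B \in F -> A != Y :\: B.
  move=> AF BF; apply/eqP => AB; have := UF _ _ AF BF.
  have -> : A :|: B = Y.
    rewrite AB setUC -[in RHS](setID Y B); congr (_ :|: _).
    by apply/esym/setIidPr; exact: FYP.
  by rewrite cY ltnn.
have <- : #|f @: F| = #|F|.
  apply: card_in_imset => A B AF BF; rewrite /f; case: ifP => _; case: ifP => _ //.
  - by move/eqP; rewrite (negPf (nocompl _ _ _ _)).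
  - by move/esym/eqP; rewrite (negPf (nocompl _ _ _ _)).
  move=> /(congr1 (setD Y)); rewrite !setDDr !setDv !set0U.
  by rewrite !(setIidPr (FYP _ _)).
apply/subset_leq_card/subsetP => _ /imsetP[A AF ->]; rewrite /f !inE.
case: ifPn => [->|dA]; first by rewrite FYP.
rewrite subsetDl cardsD cY (setIidPr (FYP _ AF)) /=; lia.
Qed.

Lemma card_sections (X : finType) (y : X) (F : {set {set X}}) :
  #|F| = #|[set A in F | y \notin A]|
       + #|[set A :\ y | A in [set A in F | y \in A]]|.
Proof.
rewrite card_in_imset.
  rewrite -cardsUI [X in _ + X](_ : _ = 0) ?addn0; last first.
    apply/eqP; rewrite cards_eq0; apply/eqP/setP => A; rewrite !inE.
    by case: (y \in A); rewrite ?andbF.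
  by apply: eq_card => A; rewrite !inE -andb_orr orNb andbT.
move=> A B; rewrite !inE => /andP[_ yA] /andP[_ yB] eqAB.
by rewrite -(setD1K yA) eqAB setD1K.
Qed.

(* Katona's theorem, by Frankl's argument: once F is stable under shifting y to
   every other point, the members containing y have, after deletion of y,
   pairwise unions of size at most 2d-2, since a union of size 2d-1 would grow
   by one when y is shifted to a point outside it. *)
Theorem union_bound (X : finType) (Y : {set X}) (d : nat)
    (F : {set {set X}}) :
  F \subset powerset Y -> d.*2 < #|Y| ->
  {in F &, forall A B, #|A :|: B| <= d.*2} ->
  #|F| <= \sum_(0 <= j < d.+1) 'C(#|Y|, j) /\
  (d.*2.+1 < #|Y| -> #|F| = \sum_(0 <= j < d.+1) 'C(#|Y|, j) ->
   {in F, forall A : {set X}, #|A| <= d}).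
Proof.
move cY: #|Y| => n.
elim: n Y d F cY => [|n IHn] Y [|d] F // cY FY dn UF.
  have F0 A : A \in F -> #|A| <= 0.
    by move=> AF; rewrite -[A]setUid; exact: UF.
  split; last by move=> _ _.
  rewrite big_nat1 bin0; apply: (@leq_trans #|[set (set0 : {set X})]|);
    last by rewrite cards1.
  apply/subset_leq_card/subsetP => A /F0.
  by rewrite leqn0 cards_eq0 inE.
(* The radius is now d+1 and [Y] has n+1 points: this is the base case, where the equality clause is
   vacuous. *)
have [ny|ny] := eqVneq n d.*2.+2.
  split; last by rewrite ny doubleS ltnn.
  by rewrite -cY; apply: union_bound_base; rewrite ?cY ?ny.
have {}dn : d.*2.+2 < n by rewrite ltn_neqAle eq_sym ny; rewrite doubleS in dn.
have [y yY] : exists y, y \in Y by apply/card_gt0P; rewrite cY.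
(* Inner induction on the number of members containing [y], which each effective shift of [y]
   lowers. *)
move: {2}(\sum_(A in F) (y \in A)).+1 (ltnSn (\sum_(A in F) (y \in A))) => w.
elim: w F FY UF => [//|w IHw] F FY UF wF.
have FYP A : A \in F -> A \subset Y by move=> /(subsetP FY); rewrite inE.
have [/exists_inP[x xY /exists_inP[A AF sA]]|] :=
    boolP [exists x in Y, exists A in F, shift y x A \notin F].
  have injs := @shift_injective _ y x.
  have [|||le_G eq_G] := IHw (compress (shift y x) F).
  - apply/subsetP => _ /imsetP[B BF ->]; rewrite inE.
    case: ifP => _; first exact: FYP.
    rewrite /shift; case: ifP => _; last exact: FYP.
    rewrite subUset sub1set xY /=; apply: subset_trans (FYP _ BF).
    exact: subsetDl.
  - exact: compress_shift_union.
  - rewrite -ltnS; apply: leq_trans wF; rewrite ltnS.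
    apply: sum_compress_lt AF sA => // B.
    rewrite /shift; case: ifP => [/andP[yB xB] _|_]; last by rewrite eqxx.
    rewrite yB !inE eqxx orbF; case: eqP => // yx.
    by rewrite -yx yB in xB.
  rewrite card_compress // in le_G eq_G; split => // dn' eqF B BF.
  have <- : #|if shift y x B \in F then B else shift y x B| = #|B|.
    by case: ifP => // _; rewrite card_shift.
  by apply: eq_G => //; apply: imset_f.
move=> /exists_inPn stab.
have {stab} stab x A : x \in Y -> A \in F -> shift y x A \in F.
  by move=> xY AF; have /exists_inPn/(_ _ AF) := stab _ xY; rewrite negbK.
pose Y' := Y :\ y.
pose F0 := [set A in F | y \notin A].
pose F1 := [set A :\ y | A in [set A in F | y \in A]].
have cY' : #|Y'| = n by move: cY; rewrite (cardsD1 y) yY => -[].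
have F0Y : F0 \subset powerset Y'.
  by apply/subsetP => A; rewrite !inE => /andP[AF yA]; rewrite subsetD1 FYP.
have F1Y : F1 \subset powerset Y'.
  apply/subsetP => A1 /imsetP[A + ->]; rewrite !inE => /andP[AF yA].
  by rewrite setSD // FYP.
have UF0 : {in F0 &, forall A B, #|A :|: B| <= d.+1.*2}.
  by move=> A B; rewrite !inE => /andP[AF _] /andP[BF _]; exact: UF.
have UF1 : {in F1 &, forall A B, #|A :|: B| <= d.*2}.
  move=> A1 B1 /imsetP[A + ->] /imsetP[B + ->].
  rewrite !inE => /andP[AF yA] /andP[BF yB].
  rewrite -setDUl; have := UF _ _ AF BF.
  rewrite (cardsD1 y) inE yA /= doubleS ltnS leq_eqVlt => /orP[/eqP cAB|//].
  have [x] : exists x, x \in Y :\: (A :|: B).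
    apply/card_gt0P; rewrite cardsD.
    have -> : Y :&: (A :|: B) = A :|: B.
      by apply/setIidPr; rewrite subUset !FYP.
    by rewrite (cardsD1 y (A :|: B)) inE yA /= cAB cY subn_gt0 ltnS ltnW.
  rewrite !inE negb_or => /andP[/andP[xA xB] xY].
  have := UF _ _ (stab _ _ xY AF) BF; rewrite /shift yA xA /=.
  have -> : (x |: A :\ y) :|: B = x |: (y |: (A :|: B) :\ y).
    apply/setP => z; rewrite !inE; case: (eqVneq z y) => [->|] /=.
      by rewrite yB !orbT.
    by rewrite orbA.
  rewrite setD1K ?inE ?yA // cardsU1 inE negb_or xA xB.
  by rewrite (cardsD1 y) inE yA /= cAB doubleS !add1n ltnn.
have [|le0 eq0] := IHn Y' d.+1 F0 cY' F0Y _ UF0; first by lia.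
have [|le1 eq1] := IHn Y' d F1 cY' F1Y _ UF1; first by lia.
have cF : #|F| = #|F0| + #|F1| by exact: card_sections.
rewrite sum_bin_recr cF; split; first exact: leq_add.
move=> _ eqF.
have eqF0 : #|F0| = \sum_(0 <= j < d.+2) 'C(n, j).
  by apply/eqP; rewrite eqn_leq le0 -(leq_add2r #|F1|) eqF leq_add2l.
have {eqF} eqF1 : #|F1| = \sum_(0 <= j < d.+1) 'C(n, j).
  by apply/(@addnI #|F0|); rewrite eqF eqF0.
have {}eq1 : {in F1, forall A : {set X}, #|A| <= d} by apply: eq1 => //; lia.
have F1E : F1 = [set A : {set X} | A \subset Y' & #|A| <= d].
  apply/eqP; rewrite eqEcard card_le_powerset cY' eqF1 leqnn andbT.
  apply/subsetP => A AF1; rewrite inE eq1 // andbT.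
  by move/subsetP/(_ _ AF1): F1Y; rewrite inE.
(* For n = 2d+3 [eq0] does not apply. Instead, a member [A] with more than d+1 points is paired with
   a disjoint [B] of size at most d such that the sizes sum to at least 2d+2. As [F1] is the full
   ball, [y |: B] is in [F], and its union with [A] is too large. *)
have {}F0d : {in F0, forall A : {set X}, #|A| <= d.+1}.
  move=> A AF0; rewrite leqNgt; apply/negP => dA.
  have AY' : A \subset Y' by move/subsetP/(_ _ AF0): F0Y; rewrite inE.
  have [AF yA] : A \in F /\ y \notin A by move: AF0; rewrite inE => /andP.
  have [B [BY' BA cB cAB]] : exists B : {set X},
      [/\ B \subset Y', [disjoint A & B], #|B| <= d & d.+1.*2 <= #|A| + #|B|].
    have [|B] := @exists_subset_card X (Y' :\: A) (minn d (n - #|A|)).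
      by rewrite cardsD cY' (setIidPr AY') geq_minr.
    rewrite subsetD => /andP[BY' BA] cB; exists B.
    have := subset_leq_card AY'; rewrite cY' => An.
    split; rewrite ?BY' 1?disjoint_sym // cB ?geq_minl //.
    by move: dn dA An; clear; lia.
  have : B \in F1 by rewrite F1E inE BY'.
  case/imsetP=> C; rewrite inE => /andP[CF yC] BC.
  have := UF _ _ AF CF; rewrite -(setD1K yC) -BC setUCA cardsU1.
  have yB : y \notin B by rewrite BC !inE eqxx.
  rewrite !inE (negPf yA) (negPf yB) /= cardsU disjoint_setI0 //.
  by rewrite cards0 subn0 => /leq_trans/(_ cAB); rewrite ltnn.
move=> A AF; have [yA|yA] := boolP (y \in A).
  rewrite (cardsD1 y) yA; apply: (eq1 (A :\ y)).
  by apply: imset_f; rewrite inE AF.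
by apply: F0d; rewrite inE AF.
Qed.

(** * Families of bounded diameter *)

Definition symdiff (X : finType) (A B : {set X}) : {set X} :=
  (A :\: B) :|: (B :\: A).

Lemma in_symdiff (X : finType) (A B : {set X}) (x : X) :
  (x \in symdiff A B) = (x \in A) (+) (x \in B).
Proof. by rewrite !inE; case: (x \in A); case: (x \in B). Qed.

Lemma symdiffK (X : finType) (c : {set X}) :
  involutive (fun A : {set X} => symdiff A c).
Proof. by move=> A; apply/setP => x; rewrite !in_symdiff -addbA addbb addbF. Qed.

Lemma symdiffC (X : finType) (A B : {set X}) : symdiff A B = symdiff B A.
Proof. by rewrite /symdiff setUC. Qed.

Lemma symdiff_sub (X : finType) (A B Y : {set X}) :
  A \subset Y -> B \subset Y -> symdiff A B \subset Y.
Proof.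
move=> AY BY; rewrite subUset.
by rewrite (subset_trans (subsetDl _ _) AY) (subset_trans (subsetDl _ _) BY).
Qed.

Lemma card_ball (X : finType) (Y c : {set X}) (d : nat) : c \subset Y ->
  #|[set A : {set X} | A \subset Y & #|symdiff A c| <= d]|
    = \sum_(0 <= j < d.+1) 'C(#|Y|, j).
Proof.
move=> cY; rewrite -card_le_powerset.
rewrite -(card_imset _ (can_inj (symdiffK c))).
apply: eq_card => A; rewrite inE; apply/imsetP/idP => [[B + ->]|/andP[AY Ad]].
  by rewrite inE => /andP[BY ->]; rewrite symdiff_sub.
by exists (symdiff A c); rewrite ?inE symdiffK // Ad symdiff_sub.
Qed.

Lemma setD1_id (X : finType) (x : X) (A : {set X}) : x \notin A -> A :\ x = A.
Proof. by move=> xA; apply/setDidPl; rewrite disjoint_sym disjoints1. Qed.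

Lemma setD1_injective (X : finType) (x : X) :
  {in [pred A : {set X} | A :\ x != A] &, injective (fun A => A :\ x)}.
Proof.
move=> A B; rewrite !inE => xA xB eqAB.
have {}xA : x \in A by apply: contraNT xA => /setD1_id ->.
have {}xB : x \in B by apply: contraNT xB => /setD1_id ->.
by rewrite -(setD1K xA) eqAB setD1K.
Qed.

Lemma card_symdiff_setU1 (X : finType) (x : X) (A c : {set X}) :
  x \notin A -> x \notin c -> #|symdiff (x |: A) c| = #|symdiff A c|.+1.
Proof.
move=> xA xc; have -> : symdiff (x |: A) c = x |: symdiff A c.
  apply/setP => z; rewrite in_setU1 !in_symdiff !inE.
  by case: (eqVneq z x) => [->|//]; rewrite (negPf xc).
by rewrite cardsU1 in_symdiff (negPf xA) (negPf xc).
Qed.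

Lemma compress_del_diam (X : finType) (x : X) (F : {set {set X}}) (D : nat) :
  {in F &, forall A B, #|symdiff A B| <= D} ->
  {in compress (fun A => A :\ x) F &, forall A B, #|symdiff A B| <= D}.
Proof.
move=> UF.
(* [A] loses [x] and [B] stays. If [x] is in [B], the deletion can be transferred to [B]; if not, it
   brings [A] closer to [B]. *)
have mixed A B : A \in F -> B \in F -> A :\ x \notin F ->
    B :\ x \in F -> #|symdiff (A :\ x) B| <= D.
  move=> AF BF sA sB.
  have xA : x \in A.
    by apply: contraNT sA => xA; rewrite setD1_id.
  have [xB|xB] := boolP (x \in B).
    rewrite (_ : symdiff _ _ = symdiff A (B :\ x)) ?UF //.
    apply/setP => z; rewrite !in_symdiff !inE.
    by case: (eqVneq z x) => [->|//]; rewrite xA xB.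
  apply: leq_trans (UF _ _ AF BF); apply/subset_leq_card/subsetP => z.
  rewrite !in_symdiff !inE.
  by case: (eqVneq z x) => [->|//]; rewrite (negPf xB).
move=> A1 B1 /imsetP[A AF ->] /imsetP[B BF ->].
case: ifPn => sA; case: ifPn => sB.
- exact: UF.
- by rewrite symdiffC; exact: mixed.
- exact: mixed.
apply: leq_trans (UF _ _ AF BF); apply/subset_leq_card/subsetP => z.
by rewrite !in_symdiff !inE; case: eqP.
Qed.

(** Exchanging one point at a time leads from [P] to [Q]. Each exchange is two steps in the Kneser
    graph: since [Z] has at least 2d+1 points, some d-set [R] is disjoint from both [P] and [P']. *)
Lemma kneser_connected (X : finType) (Z : {set X}) (d : nat)
    (col : {set X} -> bool) :
  d.*2 < #|Z| ->
  (forall P Q : {set X}, P \subset Z -> Q \subset Z -> #|P| = d -> #|Q| = d ->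
     [disjoint P & Q] -> col P -> col Q) ->
  forall P Q : {set X}, P \subset Z -> Q \subset Z -> #|P| = d -> #|Q| = d ->
    col P -> col Q.
Proof.
move=> dZ colD P Q + QZ + cQ.
move cPQ: #|P :\: Q| => m; elim: m P cPQ => [|m IH] P cPQ PZ cP colP.
  move/eqP: cPQ; rewrite cards_eq0 setD_eq0 => PQ.
  by rewrite -(eqP (_ : P == Q)) // eqEcard PQ cP cQ leqnn.
have [a] : exists a, a \in P :\: Q by apply/card_gt0P; rewrite cPQ.
rewrite inE => /andP[aQ aP].
have [b] : exists b, b \in Q :\: P.
  by apply/card_gt0P; move: cPQ; rewrite !cardsD setIC; lia.
rewrite inE => /andP[bP bQ].
have bZ : b \in Z by exact: (subsetP QZ).
pose P' := b |: P :\ a.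
have P'Z : P' \subset Z.
  by rewrite subUset sub1set bZ (subset_trans (subsetDl _ _)).
have cP' : #|P'| = d.
  by rewrite cardsU1 !inE (negPf bP) andbF -cP (cardsD1 a P) aP.
have [|R] := @exists_subset_card X (Z :\: (b |: P)) d.
  have : #|b |: P| = d.+1 by rewrite cardsU1 bP cP.
  have /setIidPr : b |: P \subset Z by rewrite subUset sub1set bZ.
  by rewrite cardsD => -> ->; move: dZ; clear; lia.
rewrite subsetD => /andP[RZ RbP] cR.
have colP' : col P'.
  apply: (colD R) => //.
    by apply: (disjointWr _ RbP); apply: setUS; exact: subsetDl.
  apply: colD colP => //; rewrite disjoint_sym; apply: (disjointWr _ RbP).
  exact: subsetUr.
apply: (IH P') => //.
apply/eqP; rewrite -eqSS -cPQ [X in _ == X](cardsD1 a) inE aP aQ /= eqSS.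
apply/eqP/eq_card => z; rewrite !inE.
by case: (eqVneq z b) => [->|] /=; rewrite ?bQ ?andbF // andbCA.
Qed.

(* If deleting x compresses F to a ball of radius d, then each set of the
   boundary sphere comes from F either unchanged or with x added. Sets given by
   disjoint d-subsets behave alike, as otherwise their distance in F would be
   2d+1; so by connectivity of the Kneser graph all behave alike, and F is a
   ball centred at c0 or at x |: c0. *)
Lemma ball_compress_del (X : finType) (Y c : {set X}) (d : nat) (x : X)
    (F : {set {set X}}) :
  F \subset powerset Y -> d.*2.+1 < #|Y| -> x \in Y -> c \subset Y ->
  {in F &, forall A B, #|symdiff A B| <= d.*2} ->
  #|F| = \sum_(0 <= j < d.+1) 'C(#|Y|, j) ->
  {in compress (fun A => A :\ x) F, forall A : {set X}, #|symdiff A c| <= d} ->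
  exists2 c' : {set X}, c' \subset Y &
    {in F, forall A : {set X}, #|symdiff A c'| <= d}.
Proof.
move=> FY dY xY cY UF cF; set G := compress _ F => Gc.
have FYP A : A \in F -> A \subset Y by move=> /(subsetP FY); rewrite inE.
have FG A : A \in F -> A :\ x \in G.
  move=> AF; apply/imsetP; have [sA|sA] := boolP (A :\ x \in F).
    by exists (A :\ x) => //; rewrite setDDl setUid sA.
  by exists A; rewrite // (negPf sA).
have GF A : A \in G -> x \notin A -> (A \in F) || (x |: A \in F).
  case/imsetP=> B BF ->; case: ifP => _ xB; first by rewrite BF.
  have [/setD1K ->|xB'] := boolP (x \in B); first by rewrite BF orbT.
  by rewrite setD1_id ?BF.
have FFG A : A \in F -> A :\ x \in F -> A \in G.
  by move=> AF sA; apply/imsetP; exists A; rewrite ?sA.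
have Gst A : A \in G -> A :\ x \in G.
  case/imsetP=> B BF ->; case: ifP => sB; first exact: FG.
  by rewrite setDDl setUid FG.
(* The centre can be moved off [x] because [G] is stable under deleting [x]. *)
pose c0 := c :\ x.
have xc0 : x \notin c0 by rewrite !inE eqxx.
have c0Y : c0 \subset Y by apply: subset_trans cY; exact: subsetDl.
have {}Gc A : A \in G -> #|symdiff A c0| <= d.
  move=> AG; have [xc|xc] := boolP (x \in c); last by rewrite /c0 setD1_id ?Gc.
  have [xA|xA] := boolP (x \in A).
    rewrite (_ : symdiff A c0 = symdiff (A :\ x) c) ?Gc ?Gst //.
    apply/setP => z; rewrite !in_symdiff !inE.
    by case: (eqVneq z x) => [->|//]; rewrite xA xc.
  apply: leq_trans (Gc _ AG); apply/subset_leq_card/subsetP => z.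
  rewrite !in_symdiff !inE.
  by case: (eqVneq z x) => [->|//]; rewrite (negPf xA).
have cG : #|G| = #|F| by apply: card_compress; exact: setD1_injective.
have GE : G = [set A : {set X} | A \subset Y & #|symdiff A c0| <= d].
  apply/eqP; rewrite eqEcard card_ball // cG cF leqnn andbT.
  apply/subsetP => A AG; rewrite inE Gc // andbT.
  case/imsetP: AG => B BF ->; case: ifP => _; first exact: FYP.
  by rewrite (subset_trans (subsetDl _ _)) ?FYP.
have YxY (P : {set X}) : P \subset Y :\ x -> P \subset Y.
  by move=> PY; apply: (subset_trans PY); exact: subsetDl.
have xP (P : {set X}) : P \subset Y :\ x -> x \notin symdiff P c0.
  rewrite in_symdiff (negPf xc0) addbF subsetD1.
  by case/andP.
pose col P := symdiff P c0 \in F.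
have colE (P Q : {set X}) : P \subset Y :\ x -> Q \subset Y :\ x ->
    #|P| = d -> #|Q| = d -> col P -> col Q.
  apply: kneser_connected => [|{}P {}Q PY QY cP cQ PQ colP].
    by rewrite (cardsD1 x) xY in dY.
  have [|//|xQF] := orP (GF (symdiff Q c0) _ (xP _ QY)).
    by rewrite GE inE symdiffK cQ leqnn andbT symdiff_sub // YxY.
  have := UF _ _ xQF colP; rewrite card_symdiff_setU1 ?xP //.
  have -> : symdiff (symdiff Q c0) (symdiff P c0) = P :|: Q.
    apply/setP => z; rewrite !in_symdiff addbACA addbb addbF inE.
    case zP: (z \in P); last by rewrite addbF.
    by rewrite (disjointFr PQ zP).
  by rewrite cardsU disjoint_setI0 // cards0 cP cQ subn0 addnn ltnn.
have [/existsP[P /and3P[PY /eqP cP colP]]|nocol] :=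
    boolP [exists P : {set X}, [&& P \subset Y :\ x, #|P| == d & col P]].
  exists c0 => // A AF; have := Gc _ (FG _ AF).
  have [xA|xA] := boolP (x \in A); last by rewrite setD1_id.
  (* If [A :\ x] is on the boundary sphere, [colE] puts it in [F]; then the compression keeps [A],
     so [A] lies in the ball. *)
  rewrite leq_eqVlt => /orP[/eqP cA|].
    apply/Gc/FFG => //; rewrite -[A :\ x](symdiffK c0).
    apply: (colE P) => //.
    by apply: symdiff_sub; apply: setSD => //; exact: FYP.
  by rewrite -[in X in _ -> X](setD1K xA) card_symdiff_setU1 // !inE eqxx.
(* No boundary set without [x] is in [F], so members without [x] are at distance less than d from
   [c0]. *)
exists (x |: c0) => [|A AF]; first by rewrite subUset sub1set xY.
have [xA|xA] := boolP (x \in A).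
  rewrite (_ : symdiff _ _ = symdiff (A :\ x) c0) ?Gc ?FG //.
  apply/setP => z; rewrite !in_symdiff !inE.
  by case: (eqVneq z x) => [->|//]; rewrite xA.
have AG : A \in G by have := FG _ AF; rewrite setD1_id.
rewrite symdiffC card_symdiff_setU1 // symdiffC.
rewrite ltn_neqAle Gc // andbT; apply: contra nocol => cA.
apply/existsP; exists (symdiff A c0); rewrite cA /col symdiffK AF andbT andbT.
apply: symdiff_sub; last exact: setSD.
by rewrite subsetD1 FYP.
Qed.

(* Kleitman's theorem, with the uniqueness of the extremal families. *)
Theorem diam_bound (X : finType) (Y : {set X}) (d : nat)
    (F : {set {set X}}) :
  F \subset powerset Y -> d.*2 < #|Y| ->
  {in F &, forall A B, #|symdiff A B| <= d.*2} ->
  #|F| <= \sum_(0 <= j < d.+1) 'C(#|Y|, j) /\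
  (d.*2.+1 < #|Y| -> #|F| = \sum_(0 <= j < d.+1) 'C(#|Y|, j) ->
   exists2 c : {set X}, c \subset Y &
     {in F, forall A : {set X}, #|symdiff A c| <= d}).
Proof.
move=> + dY.
(* Points are deleted until [F] is closed under subsets; the total size of the members decreases. *)
move: {2}(\sum_(A in F) #|A|).+1 (ltnSn (\sum_(A in F) #|A|)) => w.
elim: w F => [//|w IHw] F wF FY UF.
have FYP A : A \in F -> A \subset Y by move=> /(subsetP FY); rewrite inE.
have [/existsP[x /exists_inP[A AF sA]]|] :=
    boolP [exists x, exists A in F, A :\ x \notin F].
  have injs := @setD1_injective _ x.
  have xA : x \in A by apply: contraNT sA => /setD1_id ->.
  have xY : x \in Y by apply: (subsetP (FYP _ AF)).
  have [|||le_G eq_G] := IHw (compress (fun A => A :\ x) F).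
  - rewrite -ltnS; apply: leq_trans wF; rewrite ltnS.
    apply: sum_compress_lt AF sA => // B xB; apply: proper_card.
    by rewrite properEneq xB subsetDl.
  - apply/subsetP => B1 /imsetP[B BF ->]; rewrite inE.
    case: ifP => _; first exact: FYP.
    by rewrite (subset_trans (subsetDl _ _)) ?FYP.
  - exact: compress_del_diam.
  rewrite card_compress // in le_G eq_G; split => // dn' eqF.
  have [c cY Gc] := eq_G dn' eqF.
  exact: ball_compress_del Gc.
move=> /existsPn stab.
have {stab} stab x A : A \in F -> A :\ x \in F.
  by move=> AF; have /exists_inPn/(_ _ AF) := stab x; rewrite negbK.
have {stab} stab A C : A \in F -> A :\: C \in F.
  move cC: #|C| => m; elim: m C cC A => [|m IH] C cC A AF.
    by move/eqP: cC; rewrite cards_eq0 => /eqP ->; rewrite setD0.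
  have [y yC] : exists y, y \in C by apply/card_gt0P; rewrite cC.
  rewrite -(setD1K yC) -setDDl; apply: IH; last exact: stab.
  by move: cC; rewrite (cardsD1 y) yC => -[].
(* In a down-closed family [B :\: A] is a member, and its distance from [A] is the size of
   [A :|: B]. *)
have [|leF eqF] := union_bound FY dY.
  move=> A B AF BF; rewrite (_ : A :|: B = symdiff A (B :\: A)).
    by rewrite UF // stab.
  by apply/setP => z; rewrite in_symdiff !inE; case: (z \in A); rewrite ?orbT.
split=> // dY' /(eqF dY') {}eqF; exists set0; first exact: sub0set.
by move=> A AF; rewrite /symdiff setD0 set0D setU0; exact: eqF.
Qed.

(** * Families of signed sets *)

(** Equality would make [F] a ball about some [c]. The distances of [u] and [T :\: u] from [c :&: T]
    add up to 2d+1, so one is at most d; that pattern, continued by [c] outside [T], is in the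
    ball. *)
Lemma diam_avoid_lt (X : finType) (Y T u : {set X}) (d : nat)
    (F : {set {set X}}) :
  F \subset powerset Y -> d.*2.+1 < #|Y| ->
  {in F &, forall A B, #|symdiff A B| <= d.*2} ->
  T \subset Y -> #|T| = d.*2.+1 -> u \subset T ->
  {in F, forall A : {set X}, A :&: T != u /\ A :&: T != T :\: u} ->
  #|F| < \sum_(0 <= j < d.+1) 'C(#|Y|, j).
Proof.
move=> FY dY UF TY cT uT avoid.
have [leF eqF] := diam_bound FY (ltnW dY) UF.
rewrite ltn_neqAle leF andbT; apply/eqP => cF.
have [c cY Fc] := eqF dY cF.
have FE : F = [set A : {set X} | A \subset Y & #|symdiff A c| <= d].
  apply/eqP; rewrite eqEcard card_ball // cF leqnn andbT.
  apply/subsetP => A AF; rewrite inE Fc // andbT.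
  by move/subsetP/(_ _ AF): FY; rewrite inE.
have inF (v : {set X}) : v \subset T -> #|symdiff v (c :&: T)| <= d ->
    (v :|: (c :\: T) \in F) /\ (v :|: (c :\: T)) :&: T = v.
  move=> vT vd; split; last first.
    by rewrite setIUl (setIidPl vT) setDE -setIA [~: T :&: T]setIC setICr setI0 setU0.
  rewrite FE inE subUset (subset_trans vT TY) (subset_trans (subsetDl _ _) cY) /=.
  rewrite (_ : symdiff _ _ = symdiff v (c :&: T)) //.
  apply/setP => z; rewrite !in_symdiff !inE.
  case zT: (z \in T); first by rewrite orbF andbT.
  by rewrite andbF addbF (contraFF (subsetP vT z) zT) /= addbb.
have [vd|vd] := leqP #|symdiff u (c :&: T)| d.
  by have [vF] := inF _ uT vd; case: (avoid _ vF) => + _ vE; rewrite vE eqxx.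
have [|vF vE] := inF _ (subsetDl T u).
  have : #|symdiff (T :\: u) (c :&: T)| + #|symdiff u (c :&: T)| = #|T|.
    rewrite -cardsUI [X in _ + X](_ : _ = 0).
      rewrite addn0; apply: eq_card => z; rewrite in_setU !in_symdiff !inE.
      move: (subsetP uT z).
      by case: (z \in u) => [/(_ isT) ->|_]; case: (z \in T); case: (z \in c).
    apply/eqP; rewrite cards_eq0; apply/eqP/setP => z.
    rewrite in_setI !in_symdiff !inE; move: (subsetP uT z).
    by case: (z \in u) => [/(_ isT) ->|_]; case: (z \in T); case: (z \in c).
  rewrite cT; lia.
by case: (avoid _ vF); rewrite vE eqxx.
Qed.

Lemma card_supersets (X : finType) (T : {set X}) (k : nat) : #|T| <= k ->
  #|[set K : {set X} | #|K| == k & T \subset K]| = 'C(#|X| - #|T|, k - #|T|).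
Proof.
move=> Tk; rewrite -[X in X - _]cardsT -(setIidPr (subsetT T)) -cardsD setTI setTD.
rewrite -cards_draws.
have injT : {in [set A : {set X} | A \subset ~: T & #|A| == k - #|T|] &,
    injective (setU T)}.
  move=> A B; rewrite !inE -!disjoints_subset => /andP[AT _] /andP[BT _].
  move=> /(congr1 (fun E => E :\: T)); rewrite !setDUl setDv !set0U.
  by rewrite !(setDidPl _).
rewrite -(card_in_imset injT); apply: eq_card => K; apply/idP/imsetP.
  rewrite inE => /andP[/eqP cK TK]; exists (K :\: T).
    by rewrite inE setDE subsetIr -setDE cardsD (setIidPr TK) cK eqxx.
  by rewrite -[LHS](setID _ T) (setIidPr TK).
case=> A; rewrite !inE -disjoints_subset => /andP[AT /eqP cA] ->.
rewrite subsetUl andbT cardsU disjoint_setI0 1?disjoint_sym // cards0 cA.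
lia.
Qed.

Lemma leq_card_bigcup (I X : finType) (P : {set I}) (E : I -> {set X}) :
  #|\bigcup_(i in P) E i| <= \sum_(i in P) #|E i|.
Proof.
elim/big_rec2: _ => [|i m U _ le_Um]; first by rewrite cards0.
by rewrite (leq_trans (leq_card_setU _ _)) // leq_add2l.
Qed.

Lemma card_fibers (X Z : finType) (F : {set X * Z}) (Q : pred X) :
  {in F, forall p, Q p.1} ->
  #|F| = \sum_(x | Q x) #|[set z | (x, z) \in F]|.
Proof.
move=> FQ; rewrite -sum1_card (partition_big fst Q) //=.
apply: eq_bigr => x _; rewrite sum1dep_card.
have <- : #|pair x @: [set z | (x, z) \in F]| = #|[set z | (x, z) \in F]|.
  by apply: card_imset => z z' [].
apply: eq_card => p; rewrite inE; apply/andP/imsetP => [[pF /eqP <-]|[z + ->]].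
  by exists p.2; rewrite ?inE -surjective_pairing.
by rewrite inE eqxx.
Qed.

Lemma sum_mem (X : finType) (Q : pred X) (A : {set X}) :
  \sum_(x | Q x) (x \in A) = #|[set x in A | Q x]|.
Proof.
rewrite -sum1dep_card [RHS](eq_bigl _ _ (fun x => andbC _ _)) big_mkcondr.
by apply: eq_bigr => x _; case: (x \in A).
Qed.

(* The pair (K, N) stands for the vector with support K and set N of negative
   coordinates. P collects the bad patterns, G the supports carrying a vector
   with a bad pattern, L the supports containing the domain of a bad pattern. *)
Lemma signed_family_bound (X : finType) (k d : nat)
    (F : {set {set X} * {set X}}) :
  d.*2 < k ->
  {in F, forall p : {set X} * {set X}, p.2 \subset p.1 /\ #|p.1| = k} ->
  {in F &, forall p q : {set X} * {set X}, #|p.1 :&: q.1| = d.*2.+1 ->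
     p.2 :&: (p.1 :&: q.1) != (p.1 :&: q.1) :\: q.2} ->
  k + (2 ^ k).+1 * (k ^ 2 * 4 ^ k) < #|X| ->
  #|F| <= (\sum_(0 <= j < d.+1) 'C(k, j)) * 'C(#|X|, k).
Proof.
set m := d.*2.+1; set n := #|X|; set S := \sum_(0 <= j < d.+1) _.
move=> dk Fk Findep nk.
pose has (T u : {set X}) := [exists p in F, (T \subset p.1) && (p.2 :&: T == u)].
pose P := [set w : {set X} * {set X} |
  [&& #|w.1| == m, w.2 \subset w.1, has w.1 w.2 & has w.1 (w.1 :\: w.2)]].
pose Gw (w : {set X} * {set X}) := [set K : {set X} |
  [exists p in F, [&& p.1 == K, w.1 \subset K & p.2 :&: w.1 == w.2]]].
pose G := \bigcup_(w in P) Gw w.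
pose L := [set K : {set X} | (#|K| == k) && [exists w in P, w.1 \subset K]].
pose FK K := [set N : {set X} | (K, N) \in F].
have cGw w : w \in P -> #|Gw w| <= (k - m) * 'C(n - m.+1, k - m.+1).
  rewrite inE => /and4P[/eqP cT uT _ /exists_inP[q qF /andP[Tq /eqP qu]]].
  have [_ cq] := Fk _ qF.
  (* [q] carries the opposite pattern, so by [Findep] its support meets [K] in a further point [y],
     for which there are k-m candidates. *)
  have sub : Gw w \subset \bigcup_(y in q.1 :\: w.1)
      [set K : {set X} | #|K| == k & (y |: w.1) \subset K].
    apply/subsetP => K; rewrite inE.
    case/exists_inP=> p pF /and3P[/eqP pK TK /eqP pu].
    have [pp cp] := Fk _ pF.
    have : p.1 :&: q.1 != w.1.
      apply/eqP => pq; have := Findep _ _ pF qF; rewrite pq => /(_ cT) /eqP; apply.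
      rewrite pu -[w.1 :\: q.2]setU0 -(setDv w.1) -setDIr qu setDDr setDv set0U.
      by rewrite (setIidPr uT).
    rewrite eq_sym eqEsubset subsetI pK TK Tq /= => /subsetPn[y].
    rewrite inE => /andP[yK yq] yT; apply/bigcupP; exists y.
      by rewrite inE yT.
    by rewrite inE -pK cp eqxx subUset sub1set pK yK.
  apply: leq_trans (subset_leq_card sub) _.
  apply: leq_trans (leq_card_bigcup _ _) _.
  rewrite (eq_bigr (fun _ => 'C(n - m.+1, k - m.+1))).
    by rewrite sum_nat_const cardsD (setIidPr Tq) cq cT.
  move=> y; rewrite inE => /andP[yT yq].
  have cy : #|y |: w.1| = m.+1 by rewrite cardsU1 yT cT.
  rewrite card_supersets cy // -cq -cT; apply: proper_card.
  by rewrite properE Tq; apply/subsetPn; exists y.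
(* Double counting: a k-set [K] has at most 2^k * 2^k pairs of subsets. *)
have PL : #|P| * 'C(n - m, k - m) <= 4 ^ k * #|L|.
  have -> : #|P| * 'C(n - m, k - m) =
      \sum_(w in P) \sum_(K : {set X} | (#|K| == k) && (w.1 \subset K)) 1.
    rewrite -sum_nat_const; apply: eq_bigr => w.
    rewrite inE => /and4P[/eqP cT _ _ _].
    by rewrite sum1dep_card card_supersets cT.
  rewrite (exchange_big_dep (mem L)) /=; last first.
    by move=> w K wP /andP[cK wK]; rewrite inE cK; apply/exists_inP; exists w.
  rewrite mulnC -sum_nat_const.
  apply: leq_sum => K; rewrite inE => /andP[/eqP cK _].
  rewrite sum1dep_card -[4]/(2 * 2) expnMn -cK -card_powerset -cardsX.
  apply/subset_leq_card/subsetP => w; rewrite !inE.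
  case/andP=> /and4P[_ uT _ _] /andP[_ wK].
  by rewrite wK (subset_trans uT).
(* The chain is (n-m)|G| <= k^2 |P| C(n-m, k-m) <= k^2 4^k |L|, and n-m is at least (2^k+1) k^2 4^k;
   hence the threshold for n. *)
have GL : (2 ^ k).+1 * #|G| <= #|L|.
  have nm0 : (2 ^ k).+1 * (k ^ 2 * 4 ^ k) <= n - m by rewrite /m; lia.
  have c0 : 0 < k ^ 2 * 4 ^ k by rewrite muln_gt0 !expn_gt0 (leq_trans _ dk).
  have binE : (n - m) * ((k - m) * 'C(n - m.+1, k - m.+1))
      <= k ^ 2 * 'C(n - m, k - m).
    rewrite (subnS n m) (subnS k m); case kmE: (k - m) => [|j].
      by rewrite mul0n muln0.
    rewrite mulnCA mul_bin_diag mulnA leq_mul // -kmE -mulnn.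
    by rewrite leq_mul // leq_subr.
  rewrite -(leq_pmul2l c0).
  apply: (@leq_trans ((n - m) * #|G|)).
    by rewrite mulnCA mulnA leq_mul.
  apply: (@leq_trans (k ^ 2 * (#|P| * 'C(n - m, k - m)))); last first.
    by rewrite -mulnA leq_mul.
  rewrite [leqRHS]mulnCA.
  apply: (@leq_trans ((n - m) * (#|P| * ((k - m) * 'C(n - m.+1, k - m.+1))))).
    rewrite leq_mul // -sum_nat_const (leq_trans (leq_card_bigcup _ _)) //.
    exact: leq_sum.
  by rewrite mulnCA leq_mul.
(* Off [G] the bound [S] holds, with a deficit of at least one on [L]. On [G] the weight 2^k+1 pays
   for all 2^k sign patterns and for the indicator of [L]. *)
have pointwise (K : {set X}) : #|K| == k ->
    #|FK K| + (K \in L) <= S + (2 ^ k).+1 * (K \in G).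
  move=> /eqP cK.
  have FKK : FK K \subset powerset K.
    by apply/subsetP => N; rewrite !inE => /Fk[].
  have [KG|KG] := boolP (K \in G).
    have : #|FK K| <= 2 ^ k by rewrite -cK -card_powerset subset_leq_card.
    by case: (_ \in _); lia.
  rewrite muln0 addn0.
  have nopat w (N : {set X}) :
      w \in P -> w.1 \subset K -> N \in FK K -> N :&: w.1 != w.2.
    move=> wP wK; rewrite inE => NF; apply: contra KG => Nw.
    apply/bigcupP; exists w => //; rewrite inE; apply/exists_inP.
    by exists (K, N); rewrite //= eqxx wK.
  have Pop w : w \in P -> (w.1, w.1 :\: w.2) \in P.
    rewrite inE => /and4P[cT uT hu hTu]; rewrite inE /= cT hTu.
    by rewrite subsetDl setDDr setDv set0U (setIidPr uT).
  (* Members differing on a (2d+1)-set [T] carry opposite patterns there, which would put [K] in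
     [G]. *)
  have diam : {in FK K &, forall A B, #|symdiff A B| <= d.*2}.
    move=> A B AF BF; rewrite leqNgt; apply/negP => /exists_subset_card[T TAB cT].
    have TK : T \subset K.
      apply: subset_trans TAB _; apply: symdiff_sub.
        by move/subsetP/(_ _ AF): FKK; rewrite inE.
      by move/subsetP/(_ _ BF): FKK; rewrite inE.
    have /(nopat (T, A :&: T))/(_ TK AF)/eqP[] // : (T, A :&: T) \in P.
    rewrite !inE in AF BF; rewrite inE /= cT eqxx subsetIr /=; apply/andP; split.
      by apply/exists_inP; exists (K, A); rewrite //= TK eqxx.
    apply/exists_inP; exists (K, B); rewrite //= TK /=; apply/eqP/setP => z.
    rewrite !inE; have := subsetP TAB z; rewrite in_symdiff.
    by case: (z \in T) => [/(_ isT)|_]; case: (z \in A); case: (z \in B).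
  have [KL|_] := boolP (K \in L); last first.
    by rewrite addn0; have [] := diam_bound FKK _ diam; rewrite cK.
  move: KL; rewrite inE cK eqxx /= => /exists_inP[w wP wK].
  have := wP; rewrite inE => /and4P[/eqP cT uT /exists_inP[p pF /andP[Tp /eqP pu]] _].
  rewrite addn1 /S -cK; apply: (diam_avoid_lt FKK _ diam wK cT uT).
    (* If k = 2d+1, the vector [p] carrying the bad pattern has support [K] itself, contrary to
       [KG]. *)
    rewrite cK ltn_neqAle dk andbT; apply/eqP => mk.
    have [_ cp] := Fk _ pF.
    have wE : w.1 = K by apply/eqP; rewrite eqEcard wK cK cT -mk leqnn.
    have pE : w.1 = p.1 by apply/eqP; rewrite eqEcard Tp cp cT -mk leqnn.
    have /(nopat _ p.2 wP wK)/eqP[] // : p.2 \in FK K.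
    by rewrite inE -wE pE -surjective_pairing.
  by move=> A AF; split; [exact: nopat | exact: (nopat _ _ (Pop _ wP))].
rewrite -(leq_add2r #|L|).
apply: (@leq_trans (S * 'C(n, k) + (2 ^ k).+1 * #|G|)); last by rewrite leq_add2l.
have sumS : \sum_(K : {set X} | #|K| == k) S = S * 'C(n, k).
  by rewrite sum_nat_cond_const card_draws mulnC.
have sumL : \sum_(K : {set X} | #|K| == k) (K \in L) = #|L|.
  rewrite sum_mem; apply: eq_card => K; rewrite !inE.
  by case: (_ == k); rewrite ?andbF ?andbT.
have sumG : \sum_(K : {set X} | #|K| == k) (K \in G) <= #|G|.
  rewrite sum_mem subset_leq_card //.
  by apply/subsetP => K; rewrite inE => /andP[].
rewrite (@card_fibers _ _ F (fun K => #|K| == k)) => [|p /Fk[_ ->]]; last exact: eqxx.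
rewrite -sumL -big_split -sumS.
apply: leq_trans (leq_sum _ pointwise) _.
by rewrite big_split leq_add2l -big_distrr leq_mul.
Qed.

(** * Vectors as signed sets *)

Definition supp (n : nat) (x : {ffun 'I_n -> trit}) : {set 'I_n} :=
  [set i | (val (x i) != 0)%R].

Definition neg (n : nat) (x : {ffun 'I_n -> trit}) : {set 'I_n} :=
  [set i | (val (x i) == -1)%R].

Lemma trit_val (a : trit) : [\/ val a = -1, val a = 0 | val a = 1]%R.
Proof.
have := valP a; rewrite !inE.
by case/or3P => /eqP ->; [constructor 1 | constructor 2 | constructor 3].
Qed.

Lemma neg_sub_supp (n : nat) (x : {ffun 'I_n -> trit}) : neg x \subset supp x.
Proof. by apply/subsetP => i; rewrite !inE => /eqP ->. Qed.

Lemma supp_neg_injective (n : nat) :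
  injective (fun x : {ffun 'I_n -> trit} => (supp x, neg x)).
Proof.
move=> x y [/setP sxy /setP nxy]; apply/ffunP => i; apply: val_inj.
have := sxy i; have := nxy i; rewrite !inE.
by case: (trit_val (x i)) => ->; case: (trit_val (y i)) => ->.
Qed.

Lemma supp_neg_surjective (n : nat) (K N : {set 'I_n}) : N \subset K ->
  exists2 x : {ffun 'I_n -> trit}, supp x = K & neg x = N.
Proof.
move=> NK.
have m1P : (-1 \in [:: -1; 0; 1 : int])%R by [].
have z0P : (0 \in [:: -1; 0; 1 : int])%R by [].
have p1P : (1 \in [:: -1; 0; 1 : int])%R by [].
pose x : {ffun 'I_n -> trit} := [ffun i => if i \in N then SeqSub m1P
  else if i \in K then SeqSub p1P else SeqSub z0P].
exists x; apply/setP => i; rewrite inE ffunE.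
  by have := subsetP NK i; case: (i \in N) => [->|_] //; case: (i \in K).
by case: (i \in N) => //; case: (i \in K).
Qed.

(** A common support point contributes 1 if the signs agree and -1 = 1 - 2 if they differ. *)
Lemma scalar_prodE (n : nat) (x y : {ffun 'I_n -> trit}) :
  (scalar_prod x y = #|supp x :&: supp y|%:Z
    - #|supp x :&: supp y :&: symdiff (neg x) (neg y)|.*2%:Z)%R.
Proof.
have cardE (A : {set 'I_n}) : (#|A|%:Z = \sum_i (i \in A)%:Z)%R.
  rewrite -sum1_card big_mkcond (big_morph Posz PoszD (erefl _)) /=.
  by apply: eq_bigr => i _; case: (i \in A).
rewrite -muln2 PoszM !cardE mulr_suml -sumrB; apply: eq_bigr => i _.
rewrite !inE.
by case: (trit_val (x i)) => ->; case: (trit_val (y i)) => ->.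
Qed.

Theorem theorem8 (k : nat) (hk : (1 <= k)%N) :
  exists n0 : nat,
    forall t : int, (t < 0)%R -> odd `|t|%N -> (- k%:Z <= t)%R ->
    forall n : nat, (n0 < n)%N ->
      alpha (Jpm n k t) = (Ssum k (`|t|%N - 1) * 'C(n, k))%N.
Proof.
(* The threshold depends on k alone, so it serves every t. *)
exists (k + (2 ^ k).+1 * (k ^ 2 * 4 ^ k)) => t t0 todd kt n nk.
set d := `|t|./2.
have tE : (t = - d.*2.+1%:Z)%R by rewrite /d; lia.
have dk : d.*2 < k by lia.
rewrite (_ : `|t| - 1 = d.*2) /Ssum ?odd_double ?doubleK; last by lia.
pose enc (v : Jpm n k t) := (supp (val v), neg (val v)).
have enc_inj : injective enc.
  by move=> v w /supp_neg_injective/val_inj.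
have csupp (v : Jpm n k t) : #|supp (val v)| = k by apply/eqP; exact: (valP v).
apply/eqP; rewrite eqn_leq; apply/andP; split.
  apply/bigmax_leqP => A Aind; rewrite -(card_imset _ enc_inj).
  have := @signed_family_bound 'I_n k d (enc @: A) dk; rewrite card_ord; apply=> //.
    by move=> _ /imsetP[v _ ->]; rewrite neg_sub_supp csupp.
  move=> _ _ /imsetP[v vA ->] /imsetP[w wA ->] /=.
  set T := supp _ :&: supp _ => cT; apply/eqP => vw.
  (* Opposite signs at all 2d+1 common support points give scalar product t, hence an edge inside
     [A]. *)
  have negT i : i \in T -> (i \in neg (val v)) = ~~ (i \in neg (val w)).
    by move=> iT; move/setP/(_ i): vw; rewrite in_setI in_setD iT !andbT.
  move/forall_inP/(_ _ vA)/forall_inP/(_ _ wA): Aind => /=.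
  apply/negP; rewrite negbK /Jpm_edge; apply/andP; split.
    have [i /negT] : exists i, i \in T by apply/card_gt0P; rewrite cT.
    by apply: contra_eqN => /eqP ->; case: (_ \in _).
  rewrite scalar_prodE -/T (_ : T :&: _ = T) ?cT ?tE; first by lia.
  apply/setIidPl/subsetP => i iT; rewrite in_symdiff.
  by rewrite (negT _ iT) addNb addbb.
pose A := [set v : Jpm n k t | #|neg (val v)| <= d].
have Aind : independent A.
  apply/forall_inP => v vA; apply/forall_inP => w wA.
  rewrite /= /Jpm_edge negb_and negbK scalar_prodE; apply/orP; right.
  (* With s common support points, |D| is at most s and at most 2d, so the product s - 2|D| is at
     least -2d, above t. *)
  set D := _ :&: symdiff _ _; rewrite !inE in vA wA.
  have : #|D| <= #|supp (val v) :&: supp (val w)|.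
    by apply: subset_leq_card; exact: subsetIl.
  have : #|D| <= #|neg (val v)| + #|neg (val w)|.
    apply: leq_trans (leq_card_setU _ _); apply: subset_leq_card.
    apply/subsetP => i; rewrite in_setI in_symdiff in_setU => /andP[_].
    by case: (i \in neg _).
  by rewrite tE; lia.
apply: leq_trans (leq_bigmax_cond _ Aind).
rewrite -(card_imset _ enc_inj).
rewrite (@card_fibers _ _ (enc @: A) (fun K => #|K| == k)); last first.
  by move=> _ /imsetP[v _ ->]; rewrite csupp.
have -> : 'C(n, k) = \sum_(K : {set 'I_n} | #|K| == k) 1.
  by rewrite sum1dep_card card_draws card_ord.
rewrite big_distrr; apply: leq_sum => K /eqP cK; rewrite /= muln1.
have := card_le_powerset K d; rewrite cK => <-.
apply/subset_leq_card/subsetP => N; rewrite !inE => /andP[NK Nd].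
have [x xK xN] := supp_neg_surjective NK.
have xk : nnz x == k by rewrite -cK -xK.
by apply/imsetP; exists (exist _ x xk); rewrite ?inE /enc /= ?xN ?xK.
Qed.
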